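(* Let $\alpha,\beta\in\{0,1,\dots,n\}$ be two different particle species with $\alpha<\beta$ and fix a constant $\lambda>0$. Then the product measure $\pi^{\alpha\beta}_\lambda$ on $\{0,\dots,n\}^{\mathbb Z}$ with marginals $$\operatorname{Prob}[\eta_k=\gamma]=\begin{cases}\dfrac{1}{1+\lambda q^{2k}} & \gamma=\alpha,\\[2mm] \dfrac{\lambda q^{2k}}{1+\lambda q^{2k}} & \gamma=\beta,\\[2mm] 0 & \text{otherwise},\end{cases}\qquad k\in\mathbb Z,$$ is an invariant measure for the $n$-priority ASEP on $\mathbb Z$.
   Context: Fix an integer $n\ge1$ and reals $w>0$, $q\ge1$. The $n$-priority ASEP on $\mathbb Z$ is the Markov (interacting particle) process on $\{0,\dots,n\}^{\mathbb Z}$ with generator acting on cylinder functions by $$\mathcal Lf(\eta)=\sum_{k\in\mathbb Z}w\big(q^{\operatorname{sgn}(\eta_k-\eta_{k+1})}-\delta_{\eta_k,\eta_{k+1}}\big)\,[f(\eta^{kk+1})-f(\eta)],$$ where $\eta^{kk+1}$ is $\eta$ with the values at sites $k$ and $k+1$ interchanged and $\operatorname{sgn}(0)=0$. *)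

(* Defs.v *)
From HB Require Import structures.
From mathcomp Require Import all_boot all_order all_algebra finmap.
From mathcomp Require Import all_classical all_reals all_analysis.

Set Implicit Arguments.
Unset Strict Implicit.
Unset Printing Implicit Defensive.

Import Order.TTheory GRing.Theory Num.Theory numFieldNormedType.Exports.

Local Open Scope classical_set_scope.
Local Open Scope ring_scope.

HB.instance Definition _ (n : nat) := isPointed.Build 'I_n.+1 ord0.

Definition coord_events (n : nat) : set (set (int -> 'I_n.+1)) :=
  [set A | exists k c, A = [set eta | eta k = c]].

(* The state space {0,...,n}^Z. [config] carries the product sigma-algebra,
   [config_top], on the same underlying type, the product topology. *)
Definition config (n : nat) := g_sigma_algebraType (@coord_events n).

Definition config_top (n : nat) :=
  {ptws int -> discrete_topology 'I_n.+1}.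

HB.instance Definition _ (n : nat) := Topological.on (config_top n).

Section Generator.
Context {R : realType} {n : nat}.

(* eta^{k k+1} *)
Definition swap_next (eta : config n) (k : int) : config n :=
  fun j => if j == k then eta (k + 1)
           else if j == k + 1 then eta k else eta j.

Definition cylinder_fun (f : config n -> R) : Prop :=
  exists F : {fset int}, forall eta xi : config n,
    (forall k, k \in F -> eta k = xi k) -> f eta = f xi.

(* w (q^{sgn (a - b)} - delta_{a,b}) *)
Definition swap_rate (w q : R) (a b : 'I_n.+1) : R :=
  w * (q ^ sgz ((a : nat)%:Z - (b : nat)%:Z) - (a == b)%:R).

(* The sum is the finite-support sum over Z; for a cylinder function [f] only
   finitely many terms are nonzero, so it is the formal sum over all k. *)
Definition asep_generator (w q : R) (f : config n -> R) : config n -> R :=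
  fun eta => \sum_(k \in [set: int])
    swap_rate w q (eta k) (eta (k + 1)) * (f (swap_next eta k) - f eta).

End Generator.

Section MarkovProcess.
Context {R : realType} {n : nat}.

(* [P t eta A] is the probability to be in [A] at time [t] when started from
   [eta]; only the times t >= 0 are meaningful. *)
Definition semigroup_op (P : R -> R.-pker (config n) ~> (config n))
    (t : R) (f : config n -> R) : config n -> R :=
  fun eta => \int[P t eta]_xi f xi.

Definition continuous_config (f : config n -> R) : Prop :=
  continuous (f : config_top n -> R).

Record markov_process (P : R -> R.-pker (config n) ~> (config n)) : Prop := {
  transition0 : forall (eta : config n) (A : set (config n)),
    measurable A -> P 0 eta A = dirac eta A ;
  chapman_kolmogorov : forall (s t : R) (eta : config n) (A : set (config n)),
    0 <= s -> 0 <= t -> measurable A ->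
    P (s + t) eta A = (\int[P s eta]_xi P t xi A)%E ;
  feller : forall (t : R) (f : config n -> R),
    0 <= t -> continuous_config f -> continuous_config (semigroup_op P t f) ;
  strongly_continuous : forall f : config n -> R, continuous_config f ->
    {uniform, (fun t => semigroup_op P t f) @ 0^'+ --> f}
}.

(* f is in the domain of the generator of the semigroup, with image g *)
Definition has_generator_at (P : R -> R.-pker (config n) ~> (config n))
    (f g : config n -> R) : Prop :=
  {uniform, (fun t : R => (fun eta => t^-1 * (semigroup_op P t f eta - f eta)))
     @ 0^'+ --> g}.

Definition priority_asep (w q : R)
    (P : R -> R.-pker (config n) ~> (config n)) : Prop :=
  markov_process P /\
  forall f : config n -> R, cylinder_fun f ->
    has_generator_at P f (asep_generator w q f).

Definition invariant_measure (P : R -> R.-pker (config n) ~> (config n))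
    (mu : probability (config n) R) : Prop :=
  forall (t : R) (A : set (config n)), 0 <= t -> measurable A ->
    (\int[mu]_eta P t eta A)%E = mu A.

(* Product measure whose marginal at site k has mass function p k; these
   finite-dimensional distributions determine mu. *)
Definition product_measure_with_marginals (p : int -> 'I_n.+1 -> R)
    (mu : probability (config n) R) : Prop :=
  forall (F : {fset int}) (c : int -> 'I_n.+1),
    mu [set eta | forall k, k \in F -> eta k = c k] =
    (\prod_(k <- F) p k (c k))%:E.

Definition two_species_marginal (q lambda : R) (alpha beta : 'I_n.+1)
    (k : int) (gamma : 'I_n.+1) : R :=
  if gamma == alpha then 1 / (1 + lambda * q ^ (2 * k))
  else if gamma == beta then lambda * q ^ (2 * k) / (1 + lambda * q ^ (2 * k))
  else 0.

End MarkovProcess.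

(* Main.v *)
(** Write [nu_t f] for the integral of [f] against the law at time [t] of the
    process started from [mu], minus its integral against [mu].  Detailed
    balance gives [mu (L f) = 0] for cylinder functions [f], so [nu_t f] has
    right derivative [nu_t (L f)], uniformly in [t].  The cylinder functions
    are analytic vectors of [L]: if [f] depends on the sites of [[-N, N]], then
    [L f] depends on those of [[-N-1, N+1]] and its supremum norm is at most
    [6 w q (N+1)] times that of [f].  Hence the [k]-th order Taylor bound on
    [nu_t f] is at most [2 ||f|| (6 w q t)^k 'C(N + k, k)], which tends to [0]
    as soon as [t <= 1 / (24 w q)].  So [nu] vanishes on cylinder functions up
    to that time, then by restarting for all times, and a pi-lambda argument
    concludes.  This avoids showing that the cylinder functions form a core. *)

From HB Require Import structures.
Require Import Defs.
From mathcomp Require Import all_boot all_order all_algebra perm finmap.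
From mathcomp Require Import zify ring lra.
From mathcomp Require Import all_classical all_reals all_analysis.
From mathcomp Require Import measurable_realfun.

Import Order.TTheory GRing.Theory Num.Theory numFieldNormedType.Exports.

Set Implicit Arguments.
Unset Strict Implicit.
Unset Printing Implicit Defensive.

Local Open Scope ring_scope.

(** * Cylinder functions and their finite expansions *)

Section Cylinders.
Context {R : realType} {n : nat}.
Implicit Types (F : {fset int}) (f : config n -> R) (eta xi : config n).

(** Keeps the support explicit, where [cylinder_fun] hides it under an existential, so that its
    growth under the generator can be tracked. *)
Definition cylinder_on F f : Prop :=
  forall eta xi, (forall k, k \in F -> eta k = xi k) -> f eta = f xi.

Definition box (N : nat) : {fset int} :=
  [fset k in [seq i%:Z - N%:Z | i <- iota 0 N.*2.+1]]%fset.

Lemma mem_box N k : (k \in box N) = (`|k| <= N)%N.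
Proof.
rewrite in_fset; apply/mapP/idP => [[i]|kN].
  by rewrite mem_iota => /andP[_ iN] ->; lia.
by exists `|(k + N%:Z)%R|%N; [rewrite mem_iota; lia|lia].
Qed.

Lemma card_box N : (#|` box N| <= N.*2.+1)%N.
Proof.
by rewrite card_fseq (leq_trans (size_undup _))// size_map size_iota.
Qed.

(** The value [ord0] outside [F] is a default that functions and sets determined by [F] never
    see. *)
Definition extend {F} (c : {ffun F -> 'I_n.+1}) : config n :=
  fun k => oapp c ord0 (insub k).

Lemma extendE F (c : {ffun F -> 'I_n.+1}) (k : F) : extend c (val k) = c k.
Proof. by rewrite /extend valK. Qed.

Definition cylinder_set {F} (c : {ffun F -> 'I_n.+1}) : set (config n) :=
  [set eta | forall k, k \in F -> eta k = extend c k]%classic.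

Lemma measurable_cylinder_set F (c : {ffun F -> 'I_n.+1}) :
  measurable (cylinder_set c).
Proof.
have -> : cylinder_set c =
    (\bigcap_(k in [set` F]) [set eta : config n | eta k = extend c k])%classic.
  by apply/seteqP; split => eta h k; exact: h.
apply: fin_bigcap_measurable => // k _.
by apply: sub_sigma_algebra; exists k, (extend c k).
Qed.

(** The cylinders over patterns on [F] partition the configurations, so exactly one term survives.
    Measurability, boundedness and integrals of cylinder functions all reduce to this finite sum. *)
Lemma cylinder_onE F f eta : cylinder_on F f ->
  f eta = \sum_(c : {ffun F -> 'I_n.+1}) f (extend c) * \1_(cylinder_set c) eta.
Proof.
move=> fF; pose c0 := [ffun k : F => eta (val k)].
have eta_c0 k : k \in F -> eta k = extend c0 k.
  by move=> kF; rewrite -[k]/(val [` kF]%fset) extendE ffunE.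
rewrite (bigD1 c0) //= big1 ?addr0.
  rewrite indicE mem_set ?mulr1; first exact: fF.
  exact: eta_c0.
move=> c /eqP cc0; rewrite indicE memNset ?mulr0// => ec; apply: cc0.
by apply/ffunP => k; rewrite -extendE -ec ?fsvalP// ffunE.
Qed.

Lemma cylinder_on_measurable F f : cylinder_on F f ->
  measurable_fun [set: config n] f.
Proof.
move=> fF; rewrite (_ : f = (fun eta => \sum_(c : {ffun F -> 'I_n.+1})
    f (extend c) * \1_(cylinder_set c) eta)).
  apply: measurable_sum => c; apply: measurable_funM => //.
  by apply: measurable_indic; exact: measurable_cylinder_set.
by apply/funext => eta; exact: cylinder_onE.
Qed.

Lemma cylinder_on_bounded F f : cylinder_on F f ->
  exists M, forall eta, `|f eta| <= M.
Proof.
move=> fF; exists (\sum_(c : {ffun F -> 'I_n.+1}) `|f (extend c)|) => eta.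
rewrite (cylinder_onE _ fF) (le_trans (ler_norm_sum _ _ _))// ler_sum// => c _.
by rewrite normrM ler_piMr// indicE; case: (_ \in _); rewrite ?normr1 ?normr0.
Qed.

Lemma cylinder_onW F F' f : (F `<=` F')%fset ->
  cylinder_on F f -> cylinder_on F' f.
Proof.
by move=> /fsubsetP FF' fF eta xi e; apply: fF => k kF; exact/e/FF'.
Qed.

End Cylinders.

(** * Integrals of bounded and cylinder functions *)

Section BoundedIntegral.
Context {d} {T : measurableType d} {R : realType} (m : probability T R).
Implicit Types f g : T -> R.

Lemma bounded_integrable f (M : R) : measurable_fun setT f ->
  (forall x, `|f x| <= M) -> m.-integrable setT (EFin \o f).
Proof.
move=> mf fM; apply: measurable_bounded_integrable => //.
  exact: fin_num_fun_lty.
exists M; split; first exact: num_real.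
by move=> x Mx y _; exact: le_trans (fM y) (ltW Mx).
Qed.

Lemma normr_Rintegral_le f (M : R) : measurable_fun setT f ->
  (forall x, `|f x| <= M) -> `|\int[m]_x f x| <= M.
Proof.
move=> mf fM; have fi := bounded_integrable mf fM.
apply: le_trans (le_normr_Rintegral measurableT fi) _.
(* Total mass one turns [M] into the integral of the constant [M], and monotonicity applies. *)
rewrite -[leRHS]mulr1 -[1]/(fine 1%E) -(probability_setT m) -Rintegral_cst//.
apply: le_Rintegral => //.
- apply: (bounded_integrable (M := M)); first exact: measurableT_comp.
  by move=> x; rewrite normr_id.
- by apply: (bounded_integrable (M := `|M|)).
Qed.

Lemma Rintegral_sum I (s : seq I) (h : I -> T -> R) :
  (forall i, m.-integrable setT (EFin \o h i)) ->
  \int[m]_x (\sum_(i <- s) h i x) = \sum_(i <- s) \int[m]_x h i x.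
Proof.
move=> hi; rewrite /Rintegral; under eq_integral do rewrite -sumEFin.
rewrite integral_sum// -sum_fine// => i _.
exact: (integrable_fin_num measurableT (hi i)).
Qed.

End BoundedIntegral.

Section CylinderIntegral.
Context {R : realType} {n : nat} (m : probability (config n) R).

Lemma cylinder_on_integrable F f : cylinder_on F f ->
  m.-integrable setT (EFin \o f).
Proof.
move=> fF; have [M fM] := cylinder_on_bounded fF.
exact: bounded_integrable (cylinder_on_measurable fF) fM.
Qed.

Lemma Rintegral_cylinder_on F (f : config n -> R) : cylinder_on F f ->
  \int[m]_x f x =
  \sum_(c : {ffun F -> 'I_n.+1}) f (extend c) * fine (m (cylinder_set c)).
Proof.
move=> fF; under eq_Rintegral do rewrite (cylinder_onE _ fF).
have ci c : m.-integrable setT (EFin \o (\1_(@cylinder_set n F c) : _ -> R)).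
  by apply: integrable_indic; exact: measurable_cylinder_set.
rewrite Rintegral_sum => [|c].
  apply: eq_bigr => c _; rewrite RintegralZl//.
  by rewrite /Rintegral integral_indic// ?setIT//; exact: measurable_cylinder_set.
by have := integrableZl measurableT (f (extend c)) (ci c); apply.
Qed.

End CylinderIntegral.

(** * Support and size of the generator on cylinder functions *)

Section Generator.
Context {R : realType} {n : nat} (w q : R).
Implicit Types (f : config n -> R) (eta : config n) (N : nat) (k : int).

Definition swap_term k f : config n -> R := fun eta =>
  swap_rate w q (eta k) (eta (k + 1)) * (f (swap_next eta k) - f eta).

Lemma swap_next_cylinder F k f : k \in F -> k + 1 \in F ->
  cylinder_on F f -> cylinder_on F (fun eta => f (swap_next eta k)).
Proof.
move=> kF k1F fF eta xi e; apply: fF => j jF; rewrite /swap_next.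
by case: ifP => _; [rewrite e | case: ifP => _; rewrite e].
Qed.

Lemma swap_term_cylinder F k f : k \in F -> k + 1 \in F ->
  cylinder_on F f -> cylinder_on F (swap_term k f).
Proof.
move=> kF k1F fF eta xi e; rewrite /swap_term (fF _ _ e) !e//.
by rewrite (swap_next_cylinder kF k1F fF e).
Qed.

Lemma swap_term_out F k f : k \notin F -> k + 1 \notin F ->
  cylinder_on F f -> swap_term k f = cst 0.
Proof.
move=> kF k1F fF; apply/funext => eta; rewrite /swap_term.
rewrite (fF (swap_next eta k) eta) ?subrr ?mulr0// => j jF; rewrite /swap_next.
case: eqP => [jk|_]; first by rewrite -jk jF in kF.
by case: eqP => [jk|//]; rewrite -jk jF in k1F.
Qed.

(** If [k] lies outside [box N.+1], both [k] and [k + 1] lie outside [box N], so the exchange leaves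
    [f] unchanged. *)
Lemma asep_generator_box N f : cylinder_on (box N) f ->
  asep_generator w q f = fun eta => \sum_(k <- box N.+1) swap_term k f eta.
Proof.
move=> fN; apply/funext => eta; rewrite [RHS]fsbig_seq//.
symmetry; apply: fsbig_widen => // k [_ /= /negP kN].
rewrite -/(swap_term k f eta) (@swap_term_out (box N))//;
  by rewrite mem_box; rewrite mem_box in kN; lia.
Qed.

Lemma subset_boxS N : (box N `<=` box N.+1)%fset.
Proof. by apply/fsubsetP => k; rewrite !mem_box => /leqW. Qed.

(** Either both ends of the bond lie in [box N.+1], or one lies outside it; then both miss [box N]
    and the term is zero. *)
Lemma swap_term_box N k f : cylinder_on (box N) f ->
  cylinder_on (box N.+1) (swap_term k f).
Proof.
move=> fN.
have [/andP[kN k1N]|] := boolP ((k \in box N.+1) && (k + 1 \in box N.+1)).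
  exact: swap_term_cylinder (cylinder_onW (subset_boxS N) fN).
rewrite !mem_box => kN; rewrite (@swap_term_out (box N))// mem_box; lia.
Qed.

Lemma asep_generator_cylinder N f : cylinder_on (box N) f ->
  cylinder_on (box N.+1) (asep_generator w q f).
Proof.
move=> fN eta xi e; rewrite (asep_generator_box fN).
by apply: eq_bigr => k _; exact: (swap_term_box k fN e).
Qed.

Hypotheses (w0 : 0 < w) (q1 : 1 <= q).

(** The rate is [w * q] or [w / q] off the diagonal and zero on it; [q >= 1] makes the first the
    largest. *)
Lemma swap_rate_bound (a b : 'I_n.+1) : `|swap_rate w q a b| <= w * q.
Proof.
rewrite /swap_rate normrM (gtr0_norm w0) ler_pM2l//.
have q0 : 0 < q by apply: lt_le_trans q1.
case: (ltngtP a b) => ab.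
- have -> : (a == b) = false by apply/eqP => e; rewrite e ltnn in ab.
  rewrite ltr0_sgz ?subr_lt0// subr0 exprN1 gtr0_norm ?invr_gt0//.
  by apply: le_trans q1; rewrite invf_le1.
- have -> : (a == b) = false by apply/eqP => e; rewrite e ltnn in ab.
  by rewrite gtr0_sgz ?subr_gt0// subr0 expr1z gtr0_norm.
- by rewrite ab subrr sgz0 expr0z (val_inj ab) eqxx subrr normr0 ltW.
Qed.

(* [box N.+1] has [2 N + 3 <= 3 (N + 1)] sites, each contributing at most
   [w q * 2 M]. *)
Lemma asep_generator_bound N f (M : R) : cylinder_on (box N) f ->
  (forall eta, `|f eta| <= M) ->
  forall eta, `|asep_generator w q f eta| <= 6 * (w * q) * N.+1%:R * M.
Proof.
move=> fN fM eta; rewrite (asep_generator_box fN).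
have M0 : 0 <= M := le_trans (normr_ge0 _) (fM eta).
have wq0 : 0 <= w * q by rewrite mulr_ge0 ?ltW// (lt_le_trans ltr01).
apply: (@le_trans _ _ (\sum_(k <- box N.+1) w * q * (M + M))).
  rewrite (le_trans (ler_norm_sum _ _ _))// ler_sum// => k _.
  rewrite /swap_term normrM ler_pM ?swap_rate_bound//.
  by rewrite (le_trans (ler_normB _ _))// lerD.
rewrite big_const_seq count_predT iter_addr_0.
apply: (@le_trans _ _ ((w * q * (M + M)) *+ (3 * N.+1))).
  apply: ler_wpMn2l; first by rewrite mulr_ge0// addr_ge0.
  by apply: leq_trans (card_box _) _; lia.
by rewrite -[leLHS]mulr_natr natrM le_eqVlt; apply/orP; left; apply/eqP; ring.
Qed.

End Generator.

(** * Detailed balance across one bond *)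

Section DetailedBalance.
Context {R : realType} {n : nat} (w q lambda : R) (alpha beta : 'I_n.+1).
Hypotheses (q1 : 1 <= q) (hab : (alpha < beta)%N)
  (lambda0 : 0 < lambda).
Local Notation p := (two_species_marginal q lambda alpha beta).

(** For the pair [alpha], [beta], moving one site to the right multiplies the odds of [beta] by
    [q ^ 2], which is the ratio of the rates [w * q] and [w / q]. Otherwise the values coincide or
    one has probability zero. *)
Lemma detailed_balance k (a b : 'I_n.+1) :
  swap_rate w q b a * (p k b * p (k + 1) a) =
  swap_rate w q a b * (p k a * p (k + 1) b).
Proof.
have q0 : 0 < q := lt_le_trans ltr01 q1.
have qn0 : q != 0 by rewrite gt_eqF.
have abE : (alpha == beta) = false.
  by apply/eqP => e; move: hab; rewrite e ltnn.
have den j : 1 + lambda * q ^ (2 * j) != 0.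
  by rewrite gt_eqF// addr_gt0// mulr_gt0// exprz_gt0.
have key : swap_rate w q beta alpha * (p k beta * p (k + 1) alpha) =
           swap_rate w q alpha beta * (p k alpha * p (k + 1) beta).
  rewrite /swap_rate /two_species_marginal eqxx [beta == _]eq_sym abE eqxx.
  rewrite gtr0_sgz ?subr_gt0// ltr0_sgz ?subr_lt0// exprN1 expr1z.
  have := den (k + 1); have := den k.
  rewrite mulrDr expfzDr// -[q ^ (2 * 1)]/(q ^+ 2).
  rewrite !subr0; move: (q ^ (2 * k)) => z den1 den2; field; exact/and3P.
have [/eqP ->|aa] := boolP (a == alpha).
  have [/eqP ->|ba] := boolP (b == alpha); first by [].
  have [/eqP ->|bb] := boolP (b == beta); first exact: key.
  by rewrite /two_species_marginal (negPf ba) (negPf bb) !(mul0r, mulr0).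
have [/eqP ->|ab] := boolP (a == beta).
  have [/eqP ->|ba] := boolP (b == alpha); first by rewrite key.
  have [/eqP ->|bb] := boolP (b == beta); first by [].
  by rewrite /two_species_marginal (negPf ba) (negPf bb) !(mul0r, mulr0).
by rewrite /two_species_marginal (negPf aa) (negPf ab) !(mul0r, mulr0).
Qed.

End DetailedBalance.

(** * The generator has mean zero under the product measure *)

Section Stationarity.
Context {R : realType} {n : nat} (w q lambda : R) (alpha beta : 'I_n.+1).
Hypotheses (q1 : 1 <= q) (hab : (alpha < beta)%N)
  (lambda0 : 0 < lambda).
Local Notation p := (two_species_marginal q lambda alpha beta).
Variable mu : probability (config n) R.
Hypothesis hmu : product_measure_with_marginals p mu.
Implicit Types (F : {fset int}) (f : config n -> R) (k : int).

Lemma fine_cylinder_set F (c : {ffun F -> 'I_n.+1}) :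
  fine (mu (cylinder_set c)) = \prod_(j <- F) p j (extend c j).
Proof. by rewrite /cylinder_set hmu. Qed.

Lemma Rintegral_swap_term_in F k f : k \in F -> k + 1 \in F ->
  cylinder_on F f -> \int[mu]_eta swap_term w q k f eta = 0.
Proof.
move=> kF k1F fF; rewrite (Rintegral_cylinder_on _ (swap_term_cylinder w q kF k1F fF)).
(* Exchanging the values at [k] and [k + 1] is an involution on patterns; by
   detailed balance it matches the gain term of [c] with its loss term. *)
pose s (c : {ffun F -> 'I_n.+1}) : {ffun F -> 'I_n.+1} :=
  [ffun i => c (tperm [` kF]%fset [` k1F]%fset i)].
have sK : involutive s by move=> c; apply/ffunP => i; rewrite !ffunE tpermK.
have extend_s c : extend (s c) = swap_next (extend c) k.
  apply/funext => j; rewrite /swap_next.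
  have [->|/eqP jk] := eqVneq j k.
    rewrite -[X in extend (s c) X]/(val [` kF]%fset) extendE ffunE tpermL.
    by rewrite -extendE.
  have [->|/eqP jk1] := eqVneq j (k + 1).
    rewrite -[X in extend (s c) X]/(val [` k1F]%fset) extendE ffunE tpermR.
    by rewrite -extendE.
  rewrite /extend; case: insubP => [i _ ij|//] /=; rewrite ffunE tpermD//.
    by apply: contra_not_neq jk => e; rewrite -ij -e.
  by apply: contra_not_neq jk1 => e; rewrite -ij -e.
under eq_bigr do rewrite /swap_term mulrBr mulrBl.
rewrite sumrB (reindex_inj (inv_inj sK))/= -sumrB big1// => c _.
rewrite -extend_s sK extend_s !fine_cylinder_set extend_s.
have kk1 : (k + 1 == k) = false by apply/eqP; lia.
have k1Fk : k + 1 \in (F `\ k)%fset by rewrite !inE kk1.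
(* Only the marginals at [k] and [k + 1] feel the exchange; the other sites give a common factor. *)
rewrite !(big_fsetD1 k kF) /= !(big_fsetD1 (k + 1) k1Fk) /=.
have -> : \prod_(j <- ((F `\ k) `\ (k + 1)%R)%fset) p j (swap_next (extend c) k j) =
          \prod_(j <- ((F `\ k) `\ (k + 1)%R)%fset) p j (extend c j).
  rewrite !big_seq; apply: eq_bigr => j; rewrite !inE => /and3P[jk1 jk _].
  by rewrite /swap_next (negPf jk) (negPf jk1).
rewrite /swap_next !eqxx kk1.
have := detailed_balance w q1 hab lambda0 k (extend c k) (extend c (k + 1)).
set r := \prod_(_ <- _) _; set a := p k _; set b := p (k + 1) _.
set a' := p k _; set b' := p (k + 1) _ => e.
transitivity (f (extend c) * r *
    (swap_rate w q (extend c (k + 1)) (extend c k) * (a * b) -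
     swap_rate w q (extend c k) (extend c (k + 1)) * (a' * b'))); first by ring.
by rewrite e subrr mulr0.
Qed.

Lemma Rintegral_swap_term N k f : cylinder_on (box N) f ->
  \int[mu]_eta swap_term w q k f eta = 0.
Proof.
move=> fN.
have [/andP[kN k1N]|] := boolP ((k \in box N.+1) && (k + 1 \in box N.+1)).
  by apply: Rintegral_swap_term_in kN k1N _; exact: cylinder_onW (subset_boxS N) fN.
rewrite !mem_box => kN; rewrite (@swap_term_out _ _ _ _ (box N)) ?mem_box;
  [|lia|lia|by []].
by rewrite Rintegral_cst// mul0r.
Qed.

Lemma Rintegral_asep_generator N f : cylinder_on (box N) f ->
  \int[mu]_eta asep_generator w q f eta = 0.
Proof.
move=> fN; rewrite (asep_generator_box w q fN) Rintegral_sum.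
  by rewrite big1// => k _; exact: Rintegral_swap_term fN.
by move=> k; exact: cylinder_on_integrable (swap_term_box w q k fN).
Qed.

End Stationarity.

(** * The law reached by a kernel from a random starting point *)

Section KernelLaw.
Context {d d'} {X : measurableType d} {Y : measurableType d'} {R : realType}.
Variables (mu : probability X R) (k : R.-pker X ~> Y).

(** A name for [k x] to which a probability structure can be attached. *)
Definition kernel_law (x : X) : set Y -> \bar R := k x.

HB.instance Definition _ x := Measure.on (kernel_law x).
HB.instance Definition _ x :=
  Measure_isProbability.Build _ _ _ (kernel_law x) (prob_kernel x).

Let constant_kernel := kprobability
  (measurable_cst (mu : pprobability X R) : measurable_fun [set: unit] _).

(** Built as a composition with a constant kernel on the one-point space, so that countable
    additivity and the iterated integral formula are inherited from kernel composition. *)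
Definition mixture : set Y -> \bar R :=
  mkcomp constant_kernel (kernel.kernel_snd k) tt.

HB.instance Definition _ := Measure.on mixture.

Lemma mixtureE A : mixture A = (\int[mu]_x k x A)%E.
Proof. by []. Qed.

Let mixture_setT : mixture setT = 1%E.
Proof.
rewrite mixtureE; under eq_integral do rewrite prob_kernel.
by rewrite integral_cst// mul1e; exact: probability_setT.
Qed.

HB.instance Definition _ :=
  Measure_isProbability.Build _ _ _ mixture mixture_setT.

Lemma integral_mixture (f : Y -> \bar R) : (forall y, (0 <= f y)%E) ->
  measurable_fun setT f ->
  (\int[mixture]_y f y = \int[mu]_x \int[k x]_y f y)%E.
Proof. exact: integral_kcomp. Qed.

End KernelLaw.

(** * Integrating a uniform right derivative, and elementary bounds *)

Section UniformRightDerivative.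
Context {R : realType}.
Implicit Types h g : R -> R.

Definition uniform_right_derivative h g : Prop := forall e : R, 0 < e ->
  exists2 d : R, 0 < d & forall s t, 0 <= s -> 0 < t < d ->
    `|h (s + t) - h s - t * g s| <= e * t.

(** Tangent-line bound for a power: it replaces the integration of [s ^+ k] below. *)
Lemma exprD_ge (x d : R) k : 0 <= x -> 0 <= d ->
  x ^+ k.+1 + k.+1%:R * d * x ^+ k <= (x + d) ^+ k.+1.
Proof.
move=> x0 d0; elim: k => [|k ih]; first by rewrite expr0 !expr1; lra.
rewrite [leRHS]exprS; apply: le_trans (ler_wpM2l (addr_ge0 x0 d0) ih).
have xk : 0 <= x ^+ k by rewrite exprn_ge0.
rewrite [x ^+ k.+2]exprS !(exprS x k) -[k.+2%:R]natr1.
(* The second-order term discarded by the induction. *)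
have : 0 <= k.+1%:R * d * d * x ^+ k by rewrite !mulr_ge0.
set a := k.+1%:R; nra.
Qed.

(* Sum the increments of [h] over a fine subdivision of [[0, t]]; as the error
   is uniform in [s], no regularity of [g] is needed. *)
Lemma right_derivative_le h g (C : R) k : uniform_right_derivative h g ->
  h 0 = 0 -> (forall s, 0 <= s -> `|g s| <= C * s ^+ k) ->
  forall t, 0 <= t -> `|h t| <= C * t ^+ k.+1 / k.+1%:R.
Proof.
move=> hg h0 gC t; rewrite le_eqVlt => /predU1P[<-|t0].
  by rewrite h0 normr0 expr0n/= mulr0 mul0r.
have C0 : 0 <= C.
  by have := gC 1 ler01; rewrite expr1n mulr1; exact: le_trans.
apply/ler_addgt0Pr => e e0.
(* An error of [e / t] per unit of time adds up to [e] over the whole interval. *)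
have [d d0 hd] := hg (e / t) (divr_gt0 e0 t0).
(* [N] exceeds [t / d], which makes the mesh [u] smaller than [d]. *)
pose N := Num.bound (t / d); pose u := t / N.+1%:R.
have u0 : 0 < u by rewrite divr_gt0.
have ud : u < d.
  rewrite ltr_pdivrMr// mulrC -ltr_pdivrMr//.
  apply: lt_trans (archi_boundP (divr_ge0 (ltW t0) (ltW d0))) _.
  by rewrite ltr_nat.
have step i : `|h (i%:R * u)| <=
    C * (i%:R * u) ^+ k.+1 / k.+1%:R + e / t * (i%:R * u).
  elim: i => [|i ih]; first by rewrite !mul0r h0 normr0 expr0n/= !mulr0 mul0r addr0.
  rewrite -natr1 mulrDl mul1r; set x := i%:R * u in ih *.
  have x0 : 0 <= x by rewrite mulr_ge0// ltW.
  have hx := hd x u x0 (introT andP (conj u0 ud)).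
  have hg' : `|u * g x| <= u * (C * x ^+ k).
    by rewrite normrM gtr0_norm// ler_pM2l// gC.
  have tri : `|h (x + u)| <= `|h x| + `|u * g x| + `|h (x + u) - h x - u * g x|.
    have -> : h (x + u) = h x + u * g x + (h (x + u) - h x - u * g x) by ring.
    have -> : h x + u * g x + (h (x + u) - h x - u * g x) - h x - u * g x =
              h (x + u) - h x - u * g x by ring.
    by rewrite (le_trans (ler_normD _ _))// lerD2r ler_normD.
  apply: le_trans tri _.
  (* The derivative bound at the left endpoint, times [u], is at most the increment of its
     primitive. *)
  have pw : C * x ^+ k.+1 / k.+1%:R + u * (C * x ^+ k) <=
            C * (x + u) ^+ k.+1 / k.+1%:R.
    have -> : C * x ^+ k.+1 / k.+1%:R + u * (C * x ^+ k) =
              C / k.+1%:R * (x ^+ k.+1 + k.+1%:R * u * x ^+ k).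
      have : k.+1%:R != 0 :> R by rewrite pnatr_eq0.
      by move: (k.+1%:R) => a a0; field.
    by rewrite [leRHS]mulrAC ler_wpM2l ?divr_ge0// exprD_ge// ltW.
  rewrite [e / t * (x + u)]mulrDr addrA; apply: lerD hx.
  apply: le_trans (lerD ih hg') _.
  by rewrite addrAC lerD2r.
have := step N.+1.
have -> : N.+1%:R * u = t by rewrite mulrC divfK// pnatr_eq0.
by rewrite divfK ?gt_eqF.
Qed.

(** A positive [x] fails at any [N] above [K / x], because [2 ^+ N] exceeds [N]. *)
Lemma geometric_le0 (x K : R) : (forall k, x <= K / 2 ^+ k) -> x <= 0.
Proof.
move=> xK; rewrite leNgt; apply/negP => x0.
have K0 : 0 <= K by have := xK 0; rewrite expr0 divr1; lra.
pose N := Num.bound (K / x).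
have KN : K / x < N%:R := archi_boundP (divr_ge0 K0 (ltW x0)).
have : K / x < 2 ^+ N.
  by rewrite (lt_le_trans KN)// -natrX ler_nat ltnW// ltn_expl.
have := xK N; rewrite ler_pdivlMr ?exprn_gt0// ltr_pdivrMr// mulrC.
by move=> a b; have := le_lt_trans a b; rewrite ltxx.
Qed.

End UniformRightDerivative.

Lemma leq_bin_exp2 m k : ('C(m, k) <= 2 ^ m)%N.
Proof.
elim: m k => [|m ih] [|k]; rewrite ?bin0 ?bin0n ?expn_gt0//.
by rewrite binS expnS mul2n -addnn leq_add.
Qed.

(** * Evolution of the law of the process *)

Section Evolution.
Context {R : realType} {n : nat} (P : R -> R.-pker (config n) ~> (config n)).
Hypothesis hP : markov_process P.
Variable mu : probability (config n) R.
Implicit Types (f g : config n -> R) (A : set (config n)).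

Local Notation law t := (mixture mu (P t)).

Lemma law0 A : measurable A -> law 0 A = mu A.
Proof.
move=> mA; rewrite mixtureE.
under eq_integral do rewrite (transition0 hP)// diracE -indicE.
by rewrite integral_indic// setIT.
Qed.

Lemma integral_transition_law s t A : 0 <= s -> 0 <= t -> measurable A ->
  (\int[law s]_xi P t xi A)%E = law (s + t) A.
Proof.
move=> s0 t0 mA; rewrite integral_mixture//; last exact: measurable_kernel.
rewrite mixtureE; apply: eq_integral => eta _.
by rewrite (chapman_kolmogorov hP).
Qed.

Lemma semigroup_op_cylinder F f t xi : cylinder_on F f ->
  semigroup_op P t f xi = \sum_(c : {ffun F -> 'I_n.+1})
    f (extend c) * fine (P t xi (cylinder_set c)).
Proof. exact: (Rintegral_cylinder_on (kernel_law (P t) xi)). Qed.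

Let measurable_fine_kernel t A : measurable A ->
  measurable_fun setT (fun xi => fine (P t xi A)).
Proof.
move=> mA; apply: (@measurableT_comp _ _ _ _ _ _ fine) => //.
exact: measurable_kernel.
Qed.

Let fine_kernel_bound t A xi : measurable A -> `|fine (P t xi A)| <= 1.
Proof.
move=> mA; rewrite ger0_norm ?fine_ge0//.
rewrite -lee_fin fineK; first exact: (probability_le1 (kernel_law (P t) xi)).
exact: (fin_num_measure (kernel_law (P t) xi)).
Qed.

(** On cylinder functions the semigroup is a finite combination of kernel evaluations on fixed sets,
    each measurable in the starting point. *)
Lemma measurable_semigroup_op F f t : cylinder_on F f ->
  measurable_fun setT (semigroup_op P t f).
Proof.
move=> fF; rewrite (_ : semigroup_op P t f = fun xi =>
    \sum_(c : {ffun F -> 'I_n.+1}) f (extend c) * fine (P t xi (cylinder_set c))).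
  apply: measurable_sum => c; apply: measurable_funM => //.
  by apply: measurable_fine_kernel; exact: measurable_cylinder_set.
by apply/funext => xi; exact: semigroup_op_cylinder.
Qed.

Lemma semigroup_op_bound F f t (M : R) : cylinder_on F f ->
  (forall eta, `|f eta| <= M) -> forall xi, `|semigroup_op P t f xi| <= M.
Proof.
move=> fF fM xi; apply: (normr_Rintegral_le (kernel_law (P t) xi)) => //.
exact: cylinder_on_measurable fF.
Qed.

(** Chapman-Kolmogorov averaged over [mu], applied to each cylinder set of the expansion of [f]. *)
Lemma Rintegral_semigroup_op F f s t : 0 <= s -> 0 <= t -> cylinder_on F f ->
  \int[law s]_xi semigroup_op P t f xi = \int[law (s + t)]_xi f xi.
Proof.
move=> s0 t0 fF; under eq_Rintegral do rewrite (semigroup_op_cylinder _ _ fF).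
have ci (c : {ffun F -> 'I_n.+1}) :
    (law s).-integrable setT (EFin \o (fun xi => fine (P t xi (cylinder_set c)))).
  have mc := measurable_cylinder_set c.
  apply: (bounded_integrable _ (M := 1)); first exact: measurable_fine_kernel.
  by move=> xi; exact: fine_kernel_bound.
rewrite Rintegral_sum => [|c]; last first.
  by have := integrableZl measurableT (f (extend c)) (ci c); apply.
rewrite (Rintegral_cylinder_on _ fF); apply: eq_bigr => c _.
have mc := measurable_cylinder_set c.
rewrite RintegralZl//; congr (_ * _).
apply: etrans (congr1 fine (integral_transition_law s0 t0 mc)); congr fine.
apply: eq_integral => xi _; rewrite fineK//.
exact: (fin_num_measure (kernel_law (P t) xi)).
Qed.

Lemma has_generator_at_near f g (e : R) : has_generator_at P f g -> 0 < e ->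
  exists2 d : R, 0 < d & forall t, 0 < t < d -> forall eta,
    `|t^-1 * (semigroup_op P t f eta - f eta) - g eta| <= e.
Proof.
move=> fg e0.
(* The closed [e]-ball around [g] is a neighbourhood for uniform convergence. *)
pose V := [set h : config n -> R | forall eta, `|h eta - g eta| <= e]%classic.
have /fg : nbhs (g : {uniform (config n) -> R}) V.
  apply/uniform_nbhs; exists [set xy : R * R | `|xy.2 - xy.1| <= e]%classic; split.
    rewrite -entourage_from_ballE; exists e => //= xy /= h.
    by rewrite distrC ltW.
  by move=> h /= hV eta; exact: hV.
case=> d /= d0 hd; exists d => // t /andP[t0 td] eta.
by apply: (hd t) => //=; rewrite sub0r normrN gtr0_norm.
Qed.

(** The increment of the mean is the mean, under the law at time [s], of the semigroup increment.
    The generator limit is uniform over configurations, so one [d] serves every [s]. *)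
Lemma law_right_derivative F f g : cylinder_on F f -> cylinder_on F g ->
  has_generator_at P f g ->
  uniform_right_derivative (fun t => \int[law t]_x f x)
                           (fun t => \int[law t]_x g x).
Proof.
move=> fF gF fg e e0; have [d d0 hd] := has_generator_at_near fg e0.
exists d => // s t s0 td; have [t0 _] := andP td.
have [Mf hMf] := cylinder_on_bounded fF.
rewrite -(Rintegral_semigroup_op s0 (ltW t0) fF).
have iP : (law s).-integrable setT (EFin \o semigroup_op P t f).
  exact: bounded_integrable _ (measurable_semigroup_op t fF)
    (semigroup_op_bound t fF hMf).
have fI := cylinder_on_integrable (law s) fF.
have gI := cylinder_on_integrable (law s) gF.
have tgF : cylinder_on F (fun x => t * g x) by move=> x y /gF ->.
have tgI := cylinder_on_integrable (law s) tgF.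
rewrite -RintegralZl// -RintegralB//.
have iPf : (law s).-integrable setT (EFin \o (fun x => semigroup_op P t f x - f x)).
  by have := integrableB measurableT iP fI; apply.
rewrite -RintegralB//; apply: normr_Rintegral_le => [|eta].
  apply: measurable_funB; last exact: cylinder_on_measurable tgF.
  by apply: measurable_funB; [exact: measurable_semigroup_op fF|
                              exact: cylinder_on_measurable fF].
have -> : semigroup_op P t f eta - f eta - t * g eta =
          t * (t^-1 * (semigroup_op P t f eta - f eta) - g eta).
  by rewrite mulrBr mulVKf ?gt_eqF.
by rewrite normrM gtr0_norm// mulrC ler_pM2r// hd.
Qed.

End Evolution.

(** * Taylor bounds and invariance *)

Section Invariance.
Context {R : realType} {n : nat} (w q : R).
Hypotheses (w0 : 0 < w) (q1 : 1 <= q).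
Variable P : R -> R.-pker (config n) ~> (config n).
Hypothesis hP : priority_asep w q P.
Variable mu : probability (config n) R.
Hypothesis mu_generator : forall N f, cylinder_on (box N) f ->
  \int[mu]_eta asep_generator w q f eta = 0.
Implicit Types (f : config n -> R).

Local Notation law t := (mixture mu (P t)).

Let stationary_at s := forall N f, cylinder_on (box N) f ->
  \int[law s]_x f x = \int[mu]_x f x.

Lemma cylinder_on_cylinder_fun F f : cylinder_on F f -> cylinder_fun f.
Proof. by move=> fF; exists F. Qed.

Let wq0 : 0 < w * q.
Proof. by rewrite mulr_gt0// (lt_le_trans ltr01). Qed.

(** Induction on the order, for all [N] and [f] at once: the bound of order [k] for the generator
    image, which lives on [box N.+1], is integrated once in time. Order zero only compares two means
    bounded by [M]. *)
Lemma law_taylor_bound s k N f (M : R) : 0 <= s -> stationary_at s ->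
  cylinder_on (box N) f -> (forall eta, `|f eta| <= M) ->
  forall t, 0 <= t -> `|\int[law (s + t)]_x f x - \int[mu]_x f x| <=
    2 * M * (6 * (w * q)) ^+ k * 'C(N + k, k)%:R * t ^+ k.
Proof.
move=> s0 hs; elim: k N f M => [|k ih] N f M fN fM t t0.
  rewrite bin0 !expr0 !mulr1 mulrDl mul1r.
  have mf := cylinder_on_measurable fN.
  by rewrite (le_trans (ler_normB _ _))// lerD// normr_Rintegral_le.
have LN := asep_generator_cylinder w q fN.
have fN' := cylinder_onW (subset_boxS N) fN.
have := law_right_derivative hP.1 mu fN' LN (hP.2 f (cylinder_on_cylinder_fun fN)).
move=> deriv.
(* Subtracting the mean under [mu] keeps the increments and, by stationarity at [s], gives
   [h 0 = 0]. *)
pose h u := \int[law (s + u)]_x f x - \int[mu]_x f x.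
pose g u := \int[law (s + u)]_x asep_generator w q f x.
have hg : uniform_right_derivative h g.
  move=> e /deriv[d d0 hd]; exists d => // u v u0 vd.
  have := hd (s + u) v (addr_ge0 s0 u0) vd.
  by rewrite /h /g addrA; set a := Rintegral _ _ _; set b := Rintegral _ _ _;
     set c := \int[mu]_x _; have -> : a - c - (b - c) = a - b by ring.
have h0 : h 0 = 0 by rewrite /h addr0 (hs _ _ fN) subrr.
have := @right_derivative_le _ h g _ k hg h0 _ t t0.
move=> /(_ (2 * (6 * (w * q) * N.+1%:R * M) * (6 * (w * q)) ^+ k * 'C(N.+1 + k, k)%:R)).
(* Absorbs the factor [N + 1] from the generator bound and the [k + 1] from integration into the
   next binomial. *)
have bin : N.+1%:R * 'C(N.+1 + k, k)%:R = k.+1%:R * 'C(N + k.+1, k.+1)%:R :> R.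
  by rewrite -!natrM mul_bin_left addSnnS -addSnnS addnK.
move=> bnd; apply: le_trans (bnd _) _ => [u u0|].
  have := ih N.+1 _ _ LN (asep_generator_bound w0 q1 fN fM) u u0.
  by rewrite (mu_generator fN) subr0.
rewrite le_eqVlt; apply/orP; left; apply/eqP.
have k0 : k.+1%:R != 0 :> R by rewrite pnatr_eq0.
apply: (mulIf k0); rewrite divfK// !exprS.
move: bin; set a := N.+1%:R; set b := 'C(_, _)%:R; set c := k.+1%:R.
set x := 'C(_, _)%:R; set y := _ ^+ k; set z := t ^+ k => bin.
transitivity (2 * 6 * (w * q) * M * y * t * z * (a * b)); first by ring.
by rewrite bin; ring.
Qed.

Lemma stationary_step s t : 0 <= s -> stationary_at s ->
  0 <= t <= (24 * (w * q))^-1 -> stationary_at (s + t).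
Proof.
move=> s0 hs /andP[t0 tle] N f fN; apply/eqP; rewrite -subr_eq0 -normr_le0.
have [M fM] := cylinder_on_bounded fN.
have M0 : 0 <= M := le_trans (normr_ge0 _) (fM (fun=> ord0)).
apply: (@geometric_le0 _ _ (2 * M * 2 ^+ N)) => k.
apply: le_trans (law_taylor_bound k s0 hs fN fM t0) _.
(* Here [24 = 6 * 4]: a ratio of at most 1/4 against a binomial of at most [2 ^ (N + k)] leaves the
   decay [2 ^ N / 2 ^ k]. *)
have x4 : 0 <= 6 * (w * q) * t <= 4^-1.
  apply/andP; split; first by rewrite mulr_ge0// mulr_ge0// ltW.
  have : t * (24 * (w * q)) <= 1 by rewrite -ler_pdivlMr ?div1r// mulr_gt0.
  lra.
have -> : 2 * M * (6 * (w * q)) ^+ k * 'C(N + k, k)%:R * t ^+ k =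
  2 * M * ((6 * (w * q) * t) ^+ k * 'C(N + k, k)%:R) by rewrite [in RHS]exprMn; ring.
move: (6 * (w * q) * t) x4 => x /andP[x0 x4].
rewrite -!mulrA ler_wpM2l// ler_wpM2l//.
have -> : 2 ^+ N / 2 ^+ k = (4^-1) ^+ k * 2 ^+ (N + k) :> R.
  rewrite exprD mulrCA -exprMn -exprVn; congr (_ * _ ^+ _); lra.
rewrite ler_pM ?exprn_ge0 ?ler0n// ?lerXn2r ?nnegrE ?invr_ge0//.
by rewrite -natrX ler_nat leq_bin_exp2.
Qed.

(** The step length [u] depends neither on the function nor on the starting time, so finitely many
    steps reach [t]. *)
Lemma stationary_all t : 0 <= t -> stationary_at t.
Proof.
move=> t0; pose u := (24 * (w * q))^-1.
have u0 : 0 < u by rewrite invr_gt0 mulr_gt0.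
have main i : forall t, 0 <= t <= i%:R * u -> stationary_at t.
  elim: i => [|i ih] {t0}t /andP[t0].
    rewrite mul0r => tle; have -> : t = 0 by apply/eqP; rewrite eq_le tle.
    move=> N f fN; rewrite !(Rintegral_cylinder_on _ fN).
    apply: eq_bigr => c _; congr (_ * _).
    exact: (congr1 fine (law0 hP.1 mu (measurable_cylinder_set c))).
  rewrite -natr1 mulrDl mul1r => tle.
  have iu0 : 0 <= i%:R * u by rewrite mulr_ge0// ltW.
  have [ti|it] := leP t (i%:R * u); first by apply: ih; rewrite t0.
  rewrite -(subrK (i%:R * u) t) addrC; apply: stationary_step => //.
    by apply: ih; rewrite lexx iu0.
  by rewrite subr_ge0 ltW//= lerBlDl.
apply: (main (Num.bound (t / u))); rewrite t0 -ler_pdivrMr//.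
by rewrite ltW// archi_boundP// divr_ge0// ltW.
Qed.

Lemma invariant_of_generator : invariant_measure P mu.
Proof.
move=> t A t0 mA; rewrite -mixtureE.
(* Sets depending on finitely many sites form a pi-system (take the larger box for an intersection)
   containing every coordinate event, with [box] radius [|k|] for site [k]. *)
pose G := [set B : set (config n) |
  exists N, cylinder_on (box N) (\1_B : _ -> R)]%classic.
have GM : (G `<=` measurable)%classic.
  by move=> B [N /cylinder_on_measurable]; move/(measurable_indicP R B).2.
have GT : G setT by exists 0%N => eta xi _; rewrite !indicE !in_setT.
apply: (g_sigma_algebra_measure_unique G GM (fun=> setT)) => //.
- exact: bigcup_const.
- move=> B C [N BN] [N' CN]; exists (maxn N N') => eta xi e.
  rewrite !indicI /= (BN eta xi) ?(CN eta xi)// => k.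
    by rewrite mem_box => kN; apply: e; rewrite mem_box leq_max kN orbT.
  by rewrite mem_box => kN; apply: e; rewrite mem_box leq_max kN.
- move=> B [N BN]; have mB : measurable B by apply: GM; exists N.
  have := stationary_all t0 BN.
  rewrite /Rintegral !integral_indic// !setIT => e.
  have lf : law t B \is a fin_num by exact: fin_num_measure.
  have mf : mu B \is a fin_num by exact: fin_num_measure.
  exact: (etrans (esym (fineK lf)) (etrans (congr1 EFin e) (fineK mf))).
- by move=> _; rewrite -ge0_fin_numE//; exact: fin_num_measure.
- move: A mA; apply: sub_sigma_algebra2 => _ [k [c ->]]; exists `|k|%N.
  move=> eta xi e; rewrite !indicE; congr ((nat_of_bool _)%:R).
  by apply/idP/idP; rewrite !inE /= e ?mem_box.
Qed.

End Invariance.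

Theorem theorem3p3 (R : realType) (n : nat) (hn : (1 <= n)%N) (w q : R)
    (hw : 0 < w) (hq : 1 <= q)
    (P : R -> R.-pker (config n) ~> (config n))
    (hP : priority_asep w q P)
    (alpha beta : 'I_n.+1) (hab : (alpha < beta)%N)
    (lambda : R) (hlambda : 0 < lambda)
    (mu : probability (config n) R)
    (hpi : product_measure_with_marginals
             (two_species_marginal q lambda alpha beta) mu) :
  invariant_measure P mu.
Proof.
apply: (invariant_of_generator hw hq hP) => N f.
exact: (Rintegral_asep_generator w hq hab hlambda hpi).
Qed.
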